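(* Let $G=A\ast_C B$ be an amalgamated free product, where $C$ is an infinite cyclic subgroup with $C\neq A$ and $C\neq B$. Suppose that (1) $G$ has the unique root property; (2) the quotient $A/C^A$ admits a surjective homomorphism onto $\mathbb{Z}$, where $C^A$ denotes the normal closure of $C$ in $A$; (3) if $B$ is abelian, then $B$ admits a surjective homomorphism onto $\mathbb{Z}$. Then the abstract commensurator $\mathrm{Comm}(G)$ is not finitely generated.
   Context: A group has the unique root property if for all $x,y$ in it and every positive integer $n$, $x^n=y^n$ implies $x=y$. The abstract commensurator $\mathrm{Comm}(G)$ of a group $G$ is the group of equivalence classes of isomorphisms between finite-index subgroups of $G$, two such isomorphisms being equivalent if they agree on some finite-index subgroup of $G$ on which both are defined; the product of $\alpha:G_1\to G_1'$ and $\beta:G_2\to G_2'$ is $\alpha\beta:\alpha^{-1}(G_1'\cap G_2)\to\beta(G_1'\cap G_2)$. *)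

(* Defs.v *)
From Stdlib Require Import ZArith List.
Open Scope Z_scope.

Record Group := {
  carrier :> Type;
  gmul : carrier -> carrier -> carrier;
  gone : carrier;
  ginv : carrier -> carrier;
  gmul_assoc : forall x y z, gmul x (gmul y z) = gmul (gmul x y) z;
  gmul_1l : forall x, gmul gone x = x;
  gmul_1r : forall x, gmul x gone = x;
  gmul_Vl : forall x, gmul (ginv x) x = gone;
  gmul_Vr : forall x, gmul x (ginv x) = gone
}.

Arguments gmul {g}.
Arguments gone {g}.
Arguments ginv {g}.

Fixpoint npow {G : Group} (x : G) (n : nat) : G :=
  match n with O => gone | S m => gmul x (npow x m) end.

Definition zpow {G : Group} (x : G) (z : Z) : G :=
  match z with
  | Z0 => gone
  | Zpos p => npow x (Pos.to_nat p)
  | Zneg p => ginv (npow x (Pos.to_nat p))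
  end.

Definition subgroup {G : Group} (H : G -> Prop) : Prop :=
  H gone /\ (forall x y, H x -> H y -> H (gmul x y)) /\ (forall x, H x -> H (ginv x)).

Definition same_set {G : Group} (H K : G -> Prop) : Prop := forall x, H x <-> K x.

Definition finite_index {G : Group} (H : G -> Prop) : Prop :=
  subgroup H /\
  exists reps : list G, forall x, exists r, In r reps /\ H (gmul (ginv r) x).

Definition hom {G K : Group} (f : G -> K) : Prop :=
  forall x y, f (gmul x y) = gmul (f x) (f y).

Definition hom_on {G K : Group} (A : G -> Prop) (f : G -> K) : Prop :=
  forall x y, A x -> A y -> f (gmul x y) = gmul (f x) (f y).

(** G = A *_C B : A, B subgroups of G with A ∩ B = C, and G together with the
    inclusions of A and B is the pushout (amalgamated free product) of
    A <- C -> B, i.e. satisfies its universal property. *)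
Definition is_amalgam (G : Group) (A B C : G -> Prop) : Prop :=
  subgroup A /\ subgroup B /\ (forall x, C x <-> (A x /\ B x)) /\
  forall (K : Group) (f g : G -> K),
    hom_on A f -> hom_on B g -> (forall x, C x -> f x = g x) ->
    exists h : G -> K,
      hom h /\ (forall x, A x -> h x = f x) /\ (forall x, B x -> h x = g x) /\
      (forall h' : G -> K, hom h' -> (forall x, A x -> h' x = f x) ->
          (forall x, B x -> h' x = g x) -> forall x, h' x = h x).

Definition infinite_cyclic {G : Group} (C : G -> Prop) : Prop :=
  exists c : G, (forall x, C x <-> exists n : Z, x = zpow c n) /\
                (forall n : Z, zpow c n = gone -> n = 0).

Definition unique_root (G : Group) : Prop :=
  forall (x y : G) (n : nat), (0 < n)%nat -> npow x n = npow y n -> x = y.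

Definition normal_sub_in {G : Group} (A N : G -> Prop) : Prop :=
  subgroup N /\ (forall x, N x -> A x) /\
  (forall a n, A a -> N n -> N (gmul (ginv a) (gmul n a))).

Definition normal_closure_in {G : Group} (A C : G -> Prop) (x : G) : Prop :=
  A x /\ forall N, normal_sub_in A N -> (forall c, C c -> N c) -> N x.

Definition hom_onto_Z_on {G : Group} (A : G -> Prop) (phi : G -> Z) : Prop :=
  (forall x y, A x -> A y -> phi (gmul x y) = phi x + phi y) /\
  (forall n : Z, exists x, A x /\ phi x = n).

(** A / C^A surjects onto Z: a surjective hom A -> Z killing C^A
    (equivalently, factoring through the quotient A / C^A). *)
Definition quotient_surj_Z {G : Group} (A C : G -> Prop) : Prop :=
  exists phi : G -> Z, hom_onto_Z_on A phi /\
    (forall x, normal_closure_in A C x -> phi x = 0).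

Definition surj_Z {G : Group} (B : G -> Prop) : Prop :=
  exists phi : G -> Z, hom_onto_Z_on B phi.

Definition abelian_on {G : Group} (B : G -> Prop) : Prop :=
  forall x y, B x -> B y -> gmul x y = gmul y x.

Record commensuration (G : Group) := {
  cdom : G -> Prop;
  ccod : G -> Prop;
  cmap : G -> G;
  cinv : G -> G;
  cdom_fi : finite_index cdom;
  ccod_fi : finite_index ccod;
  cmap_hom : hom_on cdom cmap;
  cmap_in : forall x, cdom x -> ccod (cmap x);
  cinv_in : forall y, ccod y -> cdom (cinv y);
  cinvK : forall x, cdom x -> cinv (cmap x) = x;
  cmapK : forall y, ccod y -> cmap (cinv y) = y
}.

Arguments cdom {G}. Arguments ccod {G}. Arguments cmap {G}. Arguments cinv {G}.

Definition comm_is_id {G : Group} (c : commensuration G) : Prop :=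
  exists H, finite_index H /\ (forall x, H x -> cdom c x) /\
            (forall x, H x -> cmap c x = x).

(** c represents the product [a][b] (a applied first, as in alpha beta) *)
Definition comm_is_product {G : Group} (a b c : commensuration G) : Prop :=
  exists H, finite_index H /\
    (forall x, H x -> cdom a x /\ cdom b (cmap a x) /\ cdom c x) /\
    (forall x, H x -> cmap c x = cmap b (cmap a x)).

Definition comm_is_inverse {G : Group} (a c : commensuration G) : Prop :=
  exists H, finite_index H /\
    (forall y, H y -> ccod a y /\ cdom c y) /\
    (forall y, H y -> cmap c y = cinv a y).

(** Comm(G) is generated by the classes of the commensurations in L:
    every set of commensurations that contains L, contains every
    representative of the identity, and is closed under products and inverses
    (so is a union of classes forming a subgroup) contains everything. *)
Definition comm_generated_by {G : Group} (L : list (commensuration G)) : Prop :=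
  forall P : commensuration G -> Prop,
    (forall a, In a L -> P a) ->
    (forall c, comm_is_id c -> P c) ->
    (forall a b c, P a -> P b -> comm_is_product a b c -> P c) ->
    (forall a c, P a -> comm_is_inverse a c -> P c) ->
    forall c, P c.

Definition comm_finitely_generated (G : Group) : Prop :=
  exists L : list (commensuration G), comm_generated_by L.

(* Main.v *)
Require Import Defs.
From Stdlib Require Import ZArith List Lia.
From Stdlib Require Import Classical ClassicalEpsilon FunctionalExtensionality.
From Stdlib Require Import ProofIrrelevance FinFun.

(** Suppose Comm(G) is generated by commensurations whose domains and codomains
    have index at most N, and let M = N! + 1. Every commensuration then extends
    to a subgroup D such that each x in G has a power x^m in D with m prime to M.
    Hence, by uniqueness of roots, if the domain H of a commensuration F is normal
    and F fixes the powers of t^M, then F commutes with conjugation by some t^m,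
    M not dividing m. This is contradicted by twists. Let t in A map to 1 under
    A -> Z, and let H be a normal subgroup of finite index containing C, for
    which t has order M modulo H. Keep right multiplication by A on the set G,
    but alter right multiplication by b in B on each coset H x by a cocycle which
    is trivial on C: this is a new right action of G on G, and the orbit map F of 1
    restricts to an automorphism of H.

    With H = ker (G -> Z/M), applying an automorphism of B that fixes C on the
    coset H alone shows that every such automorphism is trivial. Conjugations
    then show that B is abelian; if psi : B -> Z maps c to 1 or -1, the inversion
    of ker psi shows that B = C. Otherwise some d >= 2 divides psi c, and one takes
    H = ker (G -> Z/M x Z/d) and a coboundary with values in C as cocycle. *)

Arguments gmul_assoc {g}.
Arguments gmul_1l {g}.
Arguments gmul_1r {g}.
Arguments gmul_Vl {g}.
Arguments gmul_Vr {g}.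

(** * Groups, powers and subgroups *)

Section GroupBasics.
Context {G : Group}.
Implicit Types x y z : G.

Lemma gmul_rassoc x y z : gmul (gmul x y) z = gmul x (gmul y z).
Proof. symmetry; apply gmul_assoc. Qed.

Lemma gmulKV x y : gmul x (gmul (ginv x) y) = y.
Proof. rewrite gmul_assoc, gmul_Vr; apply gmul_1l. Qed.

Lemma gmulVK x y : gmul (ginv x) (gmul x y) = y.
Proof. rewrite gmul_assoc, gmul_Vl; apply gmul_1l. Qed.

Lemma gmul_cancel_l x y z : gmul x y = gmul x z -> y = z.
Proof. intro E; rewrite <- (gmulVK x y), E; apply gmulVK. Qed.

Lemma gmul_cancel_r x y z : gmul x z = gmul y z -> x = y.
Proof.
  intro E; rewrite <- (gmul_1r x), <- (gmul_1r y), <- (gmul_Vr z), !gmul_assoc.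
  now rewrite E.
Qed.

Lemma ginv_unique x y : gmul x y = gone -> y = ginv x.
Proof. intro E; apply (gmul_cancel_l x); now rewrite E, gmul_Vr. Qed.

Lemma ginvK x : ginv (ginv x) = x.
Proof. symmetry; apply ginv_unique, gmul_Vl. Qed.

Lemma ginv1 : ginv (@gone G) = gone.
Proof. symmetry; apply ginv_unique, gmul_1l. Qed.

Lemma ginvM x y : ginv (gmul x y) = gmul (ginv y) (ginv x).
Proof.
  symmetry; apply ginv_unique.
  now rewrite gmul_rassoc, gmulKV, gmul_Vr.
Qed.

End GroupBasics.

#[export] Hint Rewrite @gmul_rassoc @gmul_1l @gmul_1r @gmul_Vl @gmul_Vr @gmulKV
  @gmulVK @ginvK @ginv1 @ginvM : grp.
Ltac grp := autorewrite with grp; try reflexivity; try assumption; auto.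

Section Powers.
Context {G : Group}.
Implicit Types x y z : G.

Lemma npow1 x : npow x 1 = x.
Proof. simpl; grp. Qed.

Lemma npow_add x m n : npow x (m + n) = gmul (npow x m) (npow x n).
Proof. induction m; simpl; grp. now rewrite IHm. Qed.

Lemma npow_mul x m n : npow x (m * n) = npow (npow x m) n.
Proof.
  induction n; [now rewrite Nat.mul_0_r|].
  rewrite Nat.mul_succ_r, Nat.add_comm, npow_add, IHn; reflexivity.
Qed.

Lemma npow_Sr x n : npow x (S n) = gmul (npow x n) x.
Proof. rewrite <- Nat.add_1_r, npow_add, npow1; reflexivity. Qed.

Lemma npow_conj x y n :
  npow (gmul x (gmul y (ginv x))) n = gmul x (gmul (npow y n) (ginv x)).
Proof. induction n; simpl; grp. rewrite IHn; grp. Qed.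

Lemma zpow_succ x n : zpow x (Z.succ n) = gmul x (zpow x n).
Proof.
  destruct n as [|p|p].
  - reflexivity.
  - simpl; now rewrite Pos.add_1_r, Pos2Nat.inj_succ.
  - destruct (Pos.succ_pred_or p) as [->|Hp]; [simpl; grp|].
    rewrite <- Hp; replace (Z.succ (Zneg (Pos.succ (Pos.pred p))))
      with (Zneg (Pos.pred p)) by lia.
    unfold zpow; rewrite Pos2Nat.inj_succ, npow_Sr; grp.
Qed.

Lemma zpow_add x m n : zpow x (m + n) = gmul (zpow x m) (zpow x n).
Proof.
  revert m; apply Z.bi_induction.
  - now intros ? ? ->.
  - simpl; grp.
  - intro m; rewrite Z.add_succ_l, !zpow_succ, gmul_rassoc; split; intro E.
    + now rewrite E.
    + now apply gmul_cancel_l in E.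
Qed.

Lemma zpow_commute x m n : gmul (zpow x m) (zpow x n) = gmul (zpow x n) (zpow x m).
Proof. now rewrite <- !zpow_add, Z.add_comm. Qed.

Lemma zpow1 x : zpow x 1 = x.
Proof. apply npow1. Qed.

Lemma zpow_opp x n : zpow x (- n) = ginv (zpow x n).
Proof. apply ginv_unique; now rewrite <- zpow_add, Z.add_opp_diag_r. Qed.

(* If [t] inverts [c] then [(t c)^2 = t^2], so [c = 1]. *)
Lemma unique_root_not_inverted (t c : G) :
  unique_root G -> gmul (ginv c) t = gmul t c -> c = gone.
Proof.
  intros UR E; apply (gmul_cancel_l t).
  rewrite gmul_1r; apply (UR _ _ 2%nat); [lia|simpl; grp].
  rewrite <- E; grp.
Qed.

End Powers.

Section Subgroups.
Context {G : Group}.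
Implicit Types (x y z : G) (D : G -> Prop).

Lemma sub1 D : subgroup D -> D gone.
Proof. now intros [? ?]. Qed.

Lemma subM D x y : subgroup D -> D x -> D y -> D (gmul x y).
Proof. intros (_ & H & _); apply H. Qed.

Lemma subV D x : subgroup D -> D x -> D (ginv x).
Proof. intros (_ & _ & H); apply H. Qed.

Lemma sub_npow D x n : subgroup D -> D x -> D (npow x n).
Proof. intros S Dx; induction n; simpl; [now apply sub1|now apply subM]. Qed.

Lemma sub_zpow D x n : subgroup D -> D x -> D (zpow x n).
Proof.
  intros S Dx; destruct n; simpl; [now apply sub1| |apply subV; auto]; now apply sub_npow.
Qed.

Lemma subM_cancel_r D x y : subgroup D -> D y -> D (gmul x y) -> D x.
Proof.
  intros S Dy Dxy; replace x with (gmul (gmul x y) (ginv y)) by grp.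
  now apply subM; [|exact Dxy|apply subV].
Qed.

Lemma subM_cancel_l D x y : subgroup D -> D x -> D (gmul x y) -> D y.
Proof.
  intros S Dx Dxy; rewrite <- (gmulVK x y).
  now apply subM; [|apply subV|].
Qed.

End Subgroups.

Ltac insub := repeat match goal with
  | |- _ => assumption
  | S : subgroup ?D |- ?D gone => apply (sub1 D)
  | S : subgroup ?D |- ?D (gmul _ _) => apply (subM D)
  | S : subgroup ?D |- ?D (ginv _) => apply (subV D)
  | S : subgroup ?D |- ?D (npow _ _) => apply (sub_npow D)
  | S : subgroup ?D |- ?D (zpow _ _) => apply (sub_zpow D)
  end; auto.

Section HomOn.
Context {G K : Group}.
Implicit Types x y : G.
Variables (D : G -> Prop) (f : G -> K).
Hypotheses (SD : subgroup D) (hf : hom_on D f).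

Lemma hom_on1 : f gone = gone.
Proof.
  apply (gmul_cancel_l (f gone)); rewrite <- hf by now apply sub1.
  now rewrite !gmul_1r.
Qed.

Lemma hom_onV x : D x -> f (ginv x) = ginv (f x).
Proof.
  intro Dx; apply ginv_unique; rewrite <- hf by insub.
  rewrite gmul_Vr; apply hom_on1.
Qed.

Lemma hom_on_npow x n : D x -> f (npow x n) = npow (f x) n.
Proof.
  intro Dx; induction n; simpl; [apply hom_on1|].
  rewrite hf, IHn; insub.
Qed.

End HomOn.

(** Pigeonhole on the cosets of x^0, ..., x^N, with N the number of representatives; the bound is
    uniform in x. *)
Lemma finite_index_npow (G : Group) (D : G -> Prop) :
  finite_index D ->
  exists N : nat, forall x, exists m, (0 < m <= N)%nat /\ D (npow x m).
Proof.
  intros [SD [reps Hreps]]; exists (length reps); intro x.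
  assert (Hf : exists f : nat -> G,
    forall i, In (f i) reps /\ D (gmul (ginv (f i)) (npow x i))).
  { exists (fun i => proj1_sig (constructive_indefinite_description _ (Hreps (npow x i)))).
    intro i; exact (proj2_sig (constructive_indefinite_description _ (Hreps (npow x i)))). }
  destruct Hf as [f Hf].
  set (l := seq 0 (S (length reps))).
  assert (E : exists i j, (i < j <= length reps)%nat /\ f i = f j).
  { apply NNPP; intro Hno.
    assert (ND : NoDup (map f l)).
    { apply Injective_map_NoDup_in; [|apply seq_NoDup].
      intros i j Hi Hj Eij; apply in_seq in Hi, Hj; apply NNPP; intro Nij.
      apply Hno; destruct (Nat.lt_ge_cases i j).
      - exists i, j; split; [lia|exact Eij].
      - exists j, i; split; [lia|now symmetry]. }
    apply NoDup_incl_length with (l' := reps) in ND.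
    - unfold l in ND; rewrite length_map, length_seq in ND; lia.
    - intros r Hr; apply in_map_iff in Hr; destruct Hr as (i & <- & _); apply Hf. }
  destruct E as (i & j & Hij & Eij).
  exists (j - i)%nat; split; [lia|].
  destruct (Hf i) as [_ Di]; destruct (Hf j) as [_ Dj].
  replace (npow x j) with (gmul (npow x i) (npow x (j - i))) in Dj
    by (rewrite <- npow_add; f_equal; lia).
  rewrite <- Eij, gmul_assoc in Dj.
  now apply subM_cancel_l in Dj.
Qed.

(** m divides N!, so a common divisor of m and N! + 1 divides 1. *)
Lemma coprime_succ_fact N m : (0 < m <= N)%nat -> Nat.gcd m (S (fact N)) = 1%nat.
Proof.
  intro Hm.
  assert (Hd : Nat.divide m (fact N)).
  { induction N as [|N IH]; [lia|].
    destruct (Nat.eq_dec m (S N)) as [->|].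
    - exists (fact N); simpl; lia.
    - apply Nat.divide_trans with (fact N); [apply IH; lia|exists (S N); reflexivity]. }
  apply Nat.divide_1_r, (Nat.divide_add_cancel_r _ (fact N)).
  - now apply Nat.divide_trans with m; [apply Nat.gcd_divide_l|].
  - rewrite Nat.add_1_r; apply Nat.gcd_divide_r.
Qed.

(** * Coprime extensions of commensurations *)

Section Extension.
Context {G : Group}.
Hypothesis UR : unique_root G.

(** A substitute for an index bound: unlike such a bound, it survives the preimages that arise when
    commensurations are composed. *)
Definition coprime_root_full (M : nat) (D : G -> Prop) : Prop :=
  forall x, exists m, (0 < m)%nat /\ Nat.gcd m M = 1%nat /\ D (npow x m).

(** [D] need not contain [cdom c]: agreement is required only where both maps are defined. Carrying
    [w'] and the condition on [D'] makes the notion symmetric, as inverses demand. *)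
Definition extends_coprimely (M : nat) (c : commensuration G) : Prop :=
  exists (D D' : G -> Prop) (w w' : G -> G),
    (subgroup D /\ subgroup D' /\ hom_on D w) /\
    ((forall x, D x -> D' (w x)) /\ (forall y, D' y -> D (w' y))) /\
    ((forall x, D x -> w' (w x) = x) /\ (forall y, D' y -> w (w' y) = y)) /\
    (coprime_root_full M D /\ coprime_root_full M D') /\
    (forall x, D x -> cdom c x -> w x = cmap c x).

Lemma inverse_hom_on (D D' : G -> Prop) (w w' : G -> G) :
  subgroup D -> hom_on D w ->
  (forall y, D' y -> D (w' y)) -> (forall x, D x -> w' (w x) = x) ->
  (forall y, D' y -> w (w' y) = y) -> hom_on D' w'.
Proof.
  intros SD hw HD Kw Kw' x y Dx Dy.
  rewrite <- (Kw' x Dx), <- (Kw' y Dy) at 1.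
  now rewrite <- hw, Kw by insub.
Qed.

Lemma coprime_mul (M m n : nat) :
  Nat.gcd m M = 1%nat -> Nat.gcd n M = 1%nat -> Nat.gcd (m * n) M = 1%nat.
Proof.
  intros Hm Hn.
  apply Nat.divide_1_r; rewrite <- Hn.
  assert (HM := Nat.gcd_divide_r (m * n) M).
  apply Nat.gcd_greatest; [|exact HM].
  apply Nat.gauss with m; [apply Nat.gcd_divide_l|].
  apply Nat.divide_1_r; rewrite <- Hm.
  apply Nat.gcd_greatest; [apply Nat.gcd_divide_r|].
  eapply Nat.divide_trans; [apply Nat.gcd_divide_l|exact HM].
Qed.

(** Some x^m enters [D], then some power w(x^m)^n enters [E]; the exponent m n is still prime to
    [M]. *)
Lemma coprime_root_full_preim (M : nat) (D E : G -> Prop) (w : G -> G) :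
  subgroup D -> hom_on D w -> coprime_root_full M D -> coprime_root_full M E ->
  coprime_root_full M (fun x => D x /\ E (w x)).
Proof.
  intros SD hw FD FE x.
  destruct (FD x) as (m & m0 & mM & Dm).
  destruct (FE (w (npow x m))) as (n & n0 & nM & En).
  exists (m * n)%nat; split; [lia|split; [now apply coprime_mul|]].
  rewrite npow_mul; split; [now apply sub_npow|].
  rewrite (hom_on_npow D); auto.
Qed.

Lemma subgroup_preim (D E : G -> Prop) (w : G -> G) :
  subgroup D -> subgroup E -> hom_on D w -> subgroup (fun x => D x /\ E (w x)).
Proof.
  intros SD SE hw; split; [|split].
  - split; [now apply sub1|rewrite (hom_on1 D); auto; now apply sub1].
  - intros x y [Dx Ex] [Dy Ey]; split; [now apply subM|].
    rewrite hw; insub.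
  - intros x [Dx Ex]; split; [now apply subV|].
    rewrite (hom_onV D); insub.
Qed.

(** The identity of G serves as extension: every x has a power in [H], so by uniqueness of roots [c]
    is the identity on its whole domain. *)
Lemma extends_coprimely_id M c : comm_is_id c -> extends_coprimely M c.
Proof.
  intros (H & FH & Hdom & Hmap).
  exists (fun _ => True), (fun _ => True), (fun x => x), (fun x => x).
  repeat split; auto.
  1, 2: intro x; exists 1%nat; repeat split; lia.
  intros x _ Dx.
  destruct (finite_index_npow _ _ FH) as [N HN]; destruct (HN x) as (m & Hm & Hx).
  apply (UR _ _ m); [lia|].
  rewrite <- (hom_on_npow (cdom c) (cmap c)); auto using cmap_hom.
  - now rewrite Hmap.
  - apply cdom_fi.
Qed.

Lemma extends_coprimely_product M a b c :
  extends_coprimely M a -> extends_coprimely M b -> comm_is_product a b c ->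
  extends_coprimely M c.
Proof.
  intros (D & D' & w & w' & (SD & SD' & hw) & (Dw & Dw') & (Kw & Kw') & (FD & FD') & Ew)
    (E & E' & v & v' & (SE & SE' & hv) & (Ev & Ev') & (Kv & Kv') & (FE & FE') & Eqv)
    (J & FJ & Jdom & Jmap).
  assert (hw' : hom_on D' w') by now apply (inverse_hom_on D D' w).
  assert (hv' : hom_on E' v') by now apply (inverse_hom_on E E' v).
  exists (fun x => D x /\ E (w x)), (fun y => E' y /\ D' (v' y)),
    (fun x => v (w x)), (fun y => w' (v' y)).
  split; [split; [|split]|split; [split|split; [split|split; [split|]]]].
  - now apply subgroup_preim.
  - now apply subgroup_preim.
  - intros x y [Dx Ex] [Dy Ey]; now rewrite hw, hv.
  - intros x [Dx Ex]; rewrite Kv; auto.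
  - intros y [Ey Dy]; rewrite Kw'; auto.
  - intros x [Dx Ex]; rewrite Kv; auto.
  - intros y [Ey Dy]; rewrite Kw'; auto.
  - now apply coprime_root_full_preim.
  - now apply coprime_root_full_preim.
  - intros x [Dx Ex] cx.
    (* The product formula is known only on [J], so the values are compared at a power of x in [J],
       and roots are taken. *)
    destruct (finite_index_npow _ _ FJ) as [N HN]; destruct (HN x) as (m & Hm & Jx).
    destruct (Jdom _ Jx) as (ax & bx & _).
    apply (UR _ _ m); [lia|].
    assert (Sc : subgroup (cdom c)) by apply cdom_fi.
    assert (hc := cmap_hom _ c).
    rewrite <- (hom_on_npow (cdom c) (cmap c)) by auto.
    rewrite <- (hom_on_npow E v), <- (hom_on_npow D w) by auto.
    rewrite Jmap, <- Ew by insub.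
    rewrite <- Ew in bx by insub.
    apply Eqv; [|exact bx].
    rewrite (hom_on_npow D); insub.
Qed.

Lemma extends_coprimely_inverse M a c :
  extends_coprimely M a -> comm_is_inverse a c -> extends_coprimely M c.
Proof.
  intros (D & D' & w & w' & (SD & SD' & hw) & (Dw & Dw') & (Kw & Kw') & (FD & FD') & Ew)
    (J & FJ & Jdom & Jmap).
  assert (hw' : hom_on D' w') by now apply (inverse_hom_on D D' w).
  exists D', D, w', w.
  repeat split; auto; try apply SD; try apply SD'.
  intros y Dy cy.
  destruct (finite_index_npow _ _ FJ) as [N HN]; destruct (HN y) as (m & Hm & Jy).
  destruct (Jdom _ Jy) as (ay & _).
  (* This preimage may lie outside [D], where nothing is known about [w]; a further power k brings
     it into [D]. *)
  set (x := cinv a (npow y m)).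
  assert (ax : cdom a x) by now apply cinv_in.
  destruct (FD x) as (k & k0 & _ & Dx).
  assert (Sa : subgroup (cdom a)) by apply cdom_fi.
  assert (E : w (npow x k) = npow y (m * k)).
  { rewrite Ew by insub.
    rewrite (hom_on_npow (cdom a) (cmap a)) by auto using cmap_hom.
    now unfold x; rewrite cmapK, npow_mul. }
  apply (UR _ _ (m * k)%nat); [lia|].
  rewrite <- (hom_on_npow D' w'), <- E, Kw by auto.
  assert (Sc : subgroup (cdom c)) by apply cdom_fi.
  assert (hc := cmap_hom _ c).
  rewrite npow_mul, <- (hom_on_npow (cdom c) (cmap c)) by auto.
  now rewrite Jmap.
Qed.

Lemma list_index_bound (L : list (commensuration G)) :
  exists N : nat, forall a, In a L -> forall x,
    (exists m, (0 < m <= N)%nat /\ cdom a (npow x m)) /\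
    (exists m, (0 < m <= N)%nat /\ ccod a (npow x m)).
Proof.
  induction L as [|a L [N HN]].
  - exists 0%nat; intros a [].
  - destruct (finite_index_npow _ _ (cdom_fi _ a)) as [N1 H1].
    destruct (finite_index_npow _ _ (ccod_fi _ a)) as [N2 H2].
    exists (N + N1 + N2)%nat; intros a' [<-|Ha'] x.
    + destruct (H1 x) as (m1 & ? & ?); destruct (H2 x) as (m2 & ? & ?).
      split; [exists m1|exists m2]; split; auto; lia.
    + destruct (HN a' Ha' x) as [(m1 & ? & ?) (m2 & ? & ?)].
      split; [exists m1|exists m2]; split; auto; lia.
Qed.

(* A word in finitely many commensurations with indices at most [N] is defined
   on a subgroup reached by steps of index at most [N], so every element has a
   power in it whose exponent is prime to [N! + 1]. *)
Lemma comm_fg_extends_coprimely :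
  comm_finitely_generated G ->
  exists M : nat, (2 <= M)%nat /\ forall c : commensuration G, extends_coprimely M c.
Proof.
  intros [L HL].
  destruct (list_index_bound L) as [N HN].
  exists (S (fact N)); split; [pose proof (lt_O_fact N); lia|].
  apply HL.
  - intros a Ha.
    exists (cdom a), (ccod a), (cmap a), (cinv a).
    split; [|split; [|split; [|split; [split|]]]]; auto.
    + split; [apply cdom_fi|split; [apply ccod_fi|apply cmap_hom]].
    + split; [apply cmap_in|apply cinv_in].
    + split; [apply cinvK|apply cmapK].
    + intro x; destruct (HN a Ha x) as [(m & Hm & Dm) _].
      exists m; split; [lia|split; auto using coprime_succ_fact].
    + intro x; destruct (HN a Ha x) as [_ (m & Hm & Dm)].
      exists m; split; [lia|split; auto using coprime_succ_fact].
  - apply extends_coprimely_id.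
  - apply extends_coprimely_product.
  - apply extends_coprimely_inverse.
Qed.

(** The extension [w] is defined at a = t^m with m prime to [M], and w(a)^M = a^M forces w(a) = a.
    So [w] respects conjugation by a; a power of h lies in [D], and uniqueness of roots carries the
    relation back to h. *)
Lemma extends_coprimely_conj (M : nat) (c : commensuration G) (t : G) :
  (2 <= M)%nat -> extends_coprimely M c ->
  (forall k, cdom c (npow t (M * k)) /\ cmap c (npow t (M * k)) = npow t (M * k)) ->
  exists m, ~ (Z.of_nat M | Z.of_nat m) /\
    forall h, cdom c h -> cdom c (gmul (npow t m) (gmul h (ginv (npow t m)))) ->
      cmap c (gmul (npow t m) (gmul h (ginv (npow t m)))) =
      gmul (npow t m) (gmul (cmap c h) (ginv (npow t m))).
Proof.
  intros M2 (D & D' & w & w' & (SD & SD' & hw) & _ & _ & (FD & _) & Ew) Ht.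
  assert (Sc : subgroup (cdom c)) by apply cdom_fi.
  assert (hc : hom_on (cdom c) (cmap c)) by apply cmap_hom.
  destruct (FD t) as (m & m0 & mM & Dt).
  exists m; split.
  { intros [k Hk].
    assert (H1 : Nat.divide M 1).
    { rewrite <- mM; apply Nat.gcd_greatest; [exists (Z.to_nat k); nia|apply Nat.divide_refl]. }
    apply Nat.divide_1_r in H1; lia. }
  set (a := npow t m) in *.
  assert (wa : w a = a).
  { apply (UR _ _ M); [lia|].
    rewrite <- (hom_on_npow D w) by auto.
    unfold a; rewrite <- npow_mul, Nat.mul_comm.
    rewrite Ew; [apply Ht| |apply Ht].
    rewrite Nat.mul_comm, npow_mul; insub. }
  intros h ch cah.
  destruct (FD h) as (k & k0 & _ & Dh).
  apply (UR _ _ k); [lia|].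
  rewrite <- (hom_on_npow (cdom c) (cmap c)) by auto.
  assert (cahk : cdom c (gmul a (gmul (npow h k) (ginv a)))).
  { rewrite <- npow_conj; insub. }
  rewrite !npow_conj.
  rewrite <- Ew, !hw, (hom_onV D), wa, Ew, (hom_on_npow (cdom c) (cmap c)); insub.
Qed.

End Extension.

(** * Target groups for the universal property *)

Section SubgroupGroup.
Context {G : Group}.
Variables (S : G -> Prop) (SS : subgroup S).

Lemma sig_inj (T : Type) (P : T -> Prop) (u v : {x | P x}) :
  proj1_sig u = proj1_sig v -> u = v.
Proof. apply eq_sig_hprop; intros; apply proof_irrelevance. Qed.

Definition subgroup_group : Group.
Proof.
  refine {| carrier := {x | S x};
    gmul := fun u v => exist _ (gmul (proj1_sig u) (proj1_sig v))
                         (subM S _ _ SS (proj2_sig u) (proj2_sig v));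
    gone := exist _ gone (sub1 S SS);
    ginv := fun u => exist _ (ginv (proj1_sig u)) (subV S _ SS (proj2_sig u)) |};
  intros; apply sig_inj; simpl; grp.
Defined.

(** The universal property takes total functions on G; the value outside [S] is a dummy. *)
Definition subgroup_proj (x : G) : subgroup_group :=
  match excluded_middle_informative (S x) with
  | left Sx => exist _ x Sx
  | right _ => gone
  end.

Lemma subgroup_projK x : S x -> proj1_sig (subgroup_proj x) = x.
Proof.
  unfold subgroup_proj; destruct (excluded_middle_informative (S x)); tauto.
Qed.

End SubgroupGroup.

Definition perm_group (X : Type) : Group.
Proof.
  refine {| carrier := {p : (X -> X) * (X -> X) |
              (forall x, snd p (fst p x) = x) /\ (forall x, fst p (snd p x) = x)};
    gmul := fun u v =>
      exist _ (fun x => fst (proj1_sig v) (fst (proj1_sig u) x),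
               fun x => snd (proj1_sig u) (snd (proj1_sig v) x)) _;
    gone := exist _ (fun x => x, fun x => x) _;
    ginv := fun u => exist _ (snd (proj1_sig u), fst (proj1_sig u)) _ |}.
  Unshelve.
  all: intros;
    repeat match goal with u : {_ | _} |- _ => destruct u as [[? ?] [? ?]] end;
    simpl in *; try (apply sig_inj; simpl; f_equal; apply functional_extensionality; congruence).
  all: split; intros; simpl; congruence.
Defined.

(* [perm_group] acts on the right: [pact (gmul u v) x] applies [u] first. *)
Definition pact {X : Type} (u : perm_group X) : X -> X := fst (proj1_sig u).

Lemma pactM {X : Type} (u v : perm_group X) x : pact (gmul u v) x = pact v (pact u x).
Proof. reflexivity. Qed.

Lemma pact_inj {X : Type} (u v : perm_group X) : (forall x, pact u x = pact v x) -> u = v.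
Proof.
  destruct u as [[f f'] [K1 K2]], v as [[g g'] [L1 L2]]; unfold pact; simpl in *.
  intro E; apply sig_inj; simpl; f_equal; apply functional_extensionality; auto.
  intro x; rewrite <- (K1 (g' x)), E, L2; reflexivity.
Qed.

Definition Z_group : Group.
Proof.
  refine {| carrier := Z; gmul := Z.add; gone := 0; ginv := Z.opp |}; intros; lia.
Defined.

Definition Zmod_group (d : Z) : Group.
Proof.
  refine {| carrier := {z | z mod d = z};
    gmul := fun u v => exist _ ((proj1_sig u + proj1_sig v) mod d) (Zmod_mod _ _);
    gone := exist _ 0 (Zmod_0_l d);
    ginv := fun u => exist _ ((- proj1_sig u) mod d) (Zmod_mod _ _) |};
  intros; apply sig_inj; simpl;
  repeat match goal with u : {_ | _} |- _ => destruct u end; simpl.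
  - rewrite Zplus_mod_idemp_l, Zplus_mod_idemp_r; f_equal; lia.
  - assumption.
  - now rewrite Z.add_0_r.
  - rewrite Zplus_mod_idemp_l, Z.add_opp_diag_l; apply Zmod_0_l.
  - rewrite Zplus_mod_idemp_r, Z.add_opp_diag_r; apply Zmod_0_l.
Defined.

(** * Twisted right actions of an amalgam *)

Section Amalgam.
Context {G : Group} {A B C : G -> Prop}.
Hypothesis amal : is_amalgam G A B C.
Implicit Types x y a b c h : G.

Let SA : subgroup A. Proof. apply amal. Qed.
Let SB : subgroup B. Proof. apply amal. Qed.

Lemma amalgam_sub_A c : C c -> A c.
Proof. intro Cc; now apply amal. Qed.

Lemma amalgam_sub_B c : C c -> B c.
Proof. intro Cc; now apply amal. Qed.

Lemma amalgam_ext (K : Group) (f g : G -> K) :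
  hom_on A f -> hom_on B g -> (forall x, C x -> f x = g x) ->
  exists h : G -> K, hom h /\ (forall x, A x -> h x = f x) /\ (forall x, B x -> h x = g x).
Proof.
  intros hf hg E; destruct amal as (_ & _ & _ & U).
  destruct (U K f g hf hg E) as (h & ? & ? & ? & _); exists h; auto.
Qed.

(** The inclusions of A and B into [S] extend to a homomorphism from G to [S]. Followed by the
    inclusion of [S] in G, it agrees with the identity on A and B, hence everywhere by
    uniqueness. *)
Lemma amalgam_ind (S : G -> Prop) :
  subgroup S -> (forall x, A x -> S x) -> (forall x, B x -> S x) -> forall x, S x.
Proof.
  intros SS HA HB x.
  assert (hS : forall D : G -> Prop, subgroup D -> (forall x, D x -> S x) ->
    hom_on D (subgroup_proj S SS)).
  { intros D SD HD u v Du Dv; apply sig_inj; simpl.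
    rewrite !subgroup_projK; auto; insub. }
  destruct (amalgam_ext (subgroup_group S SS) (subgroup_proj S SS) (subgroup_proj S SS))
    as (h & hh & hA & hB); auto.
  destruct amal as (_ & _ & _ & U).
  destruct (U G (fun x => x) (fun x => x)) as (k & _ & _ & _ & Uk); try now intros ?.
  rewrite (Uk (fun x => x)) by now intros ?.
  rewrite <- (Uk (fun x => proj1_sig (h x))).
  - apply proj2_sig.
  - intros u v; now rewrite hh.
  - intros u Au; rewrite hA by auto; apply subgroup_projK; auto.
  - intros u Bu; rewrite hB by auto; apply subgroup_projK; auto.
Qed.

Lemma one_in_C : C gone.
Proof. apply amal; split; insub. Qed.

Section Twist.
Variable H : G -> Prop.
Hypothesis FH : finite_index H.

Let SH : subgroup H. Proof. apply FH. Qed.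

(* [beta x] prescribes how right multiplication by elements of [B] is altered
   on the coset [H x]; the cocycle identity makes it an action of [B]. *)
Record twist_cocycle (beta : G -> G -> G) : Prop := {
  cocycle_coset : forall h x b, H h -> beta (gmul h x) b = beta x b;
  cocycle_B : forall x b, B b -> B (beta x b);
  cocycleM : forall x b b', B b -> B b' ->
    beta x (gmul b b') = gmul (beta x b) (beta (gmul x b) b');
  cocycle_C : forall x c, C c -> beta x c = c;
  cocycle_H : forall x b, B b ->
    H (gmul (gmul x (beta x b)) (ginv (gmul x b)))
}.

Definition same_coset x y := H (gmul x (ginv y)).

Lemma same_coset_refl x : same_coset x x.
Proof. unfold same_coset; rewrite gmul_Vr; now apply sub1. Qed.

Lemma same_coset_sym x y : same_coset x y -> same_coset y x.
Proof.
  unfold same_coset; intro E; replace (gmul y (ginv x)) with (ginv (gmul x (ginv y))) by grp.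
  insub.
Qed.

Lemma same_coset_trans x y z : same_coset x y -> same_coset y z -> same_coset x z.
Proof.
  unfold same_coset; intros E F.
  replace (gmul x (ginv z)) with (gmul (gmul x (ginv y)) (gmul y (ginv z))) by grp.
  insub.
Qed.

Lemma same_cosetM x y z : same_coset x y -> same_coset (gmul x z) (gmul y z).
Proof.
  unfold same_coset; intro E.
  now replace (gmul (gmul x z) (ginv (gmul y z))) with (gmul x (ginv y)) by grp.
Qed.

Section Cocycle.
Variable beta : G -> G -> G.
Hypothesis hbeta : twist_cocycle beta.

Lemma cocycle_same_coset x y b : same_coset x y -> beta x b = beta y b.
Proof.
  intro E; rewrite <- (cocycle_coset _ hbeta _ y b E); f_equal; grp.
Qed.

(** The cocycle identity refers to the coset of x b, whereas the altered action moves x to x (beta x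
    b); [cocycle_H] says that these cosets coincide. *)
Lemma cocycle_mulM x b b' : B b -> B b' ->
  gmul (gmul x (beta x b)) (beta (gmul x (beta x b)) b') = gmul x (beta x (gmul b b')).
Proof.
  intros Bb Bb'.
  rewrite (cocycle_same_coset (gmul x (beta x b)) (gmul x b)) by now apply cocycle_H.
  rewrite (cocycleM _ hbeta) by auto; grp.
Qed.

Lemma twist_action :
  exists Phi : G -> perm_group G, hom Phi /\
    (forall a x, A a -> pact (Phi a) x = gmul x a) /\
    (forall b x, B b -> pact (Phi b) x = gmul x (beta x b)).
Proof.
  set (P := fun p : (G -> G) * (G -> G) =>
              (forall x, snd p (fst p x) = x) /\ (forall x, fst p (snd p x) = x)).
  assert (PA : forall a, P (fun x => gmul x a, fun x => gmul x (ginv a))).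
  { intro a; split; intro x; simpl; grp. }
  (* The altered multiplications by b and by b^-1 are mutually inverse, since the cocycle is trivial
     at 1, an element of C. *)
  assert (PB : forall b, B b -> P (fun x => gmul x (beta x b), fun x => gmul x (beta x (ginv b)))).
  { intros b Bb; split; intro x; simpl; rewrite cocycle_mulM by insub; grp.
    all: rewrite (cocycle_C _ hbeta) by apply one_in_C; grp. }
  set (RA := fun a => exist P _ (PA a) : perm_group G).
  set (RB := fun b => match excluded_middle_informative (B b) with
                      | left Bb => exist P _ (PB b Bb) : perm_group G
                      | right _ => gone
                      end).
  assert (ERB : forall b x, B b -> pact (RB b) x = gmul x (beta x b)).
  { intros b x Bb; unfold RB; destruct (excluded_middle_informative (B b)); tauto. }
  destruct (amalgam_ext (perm_group G) RA RB) as (Phi & hPhi & PhiA & PhiB).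
  - intros a a' _ _; apply pact_inj; intro x; rewrite pactM; unfold RA, pact; simpl; grp.
  - intros b b' Bb Bb'; apply pact_inj; intro x; rewrite pactM, !ERB by insub.
    now rewrite cocycle_mulM.
  - intros c Cc; apply pact_inj; intro x; rewrite ERB by now apply amalgam_sub_B.
    now rewrite (cocycle_C _ hbeta).
  - exists Phi; split; [exact hPhi|split].
    + intros a x Aa; now rewrite PhiA.
    + intros b x Bb; now rewrite PhiB, ERB.
Qed.

(* [F] is the orbit map of [1] under the altered right action of [G] on itself. *)
Lemma twist_map :
  exists F : G -> G,
    F gone = gone /\
    (forall x a, A a -> F (gmul x a) = gmul (F x) a) /\
    (forall x b, B b -> F (gmul x b) = gmul (F x) (beta x b)) /\
    (forall x, same_coset (F x) x) /\ hom_on H F.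
Proof.
  destruct twist_action as (Phi & hPhi & PhiA & PhiB).
  assert (Phi1 : forall x, pact (Phi gone) x = x).
  { intro x; rewrite PhiA by insub; grp. }
  assert (PhiV : forall g x, pact (Phi g) (pact (Phi (ginv g)) x) = x).
  { intros g x; rewrite <- pactM, <- hPhi, gmul_Vl; apply Phi1. }
  assert (PhiV' : forall g x, pact (Phi (ginv g)) (pact (Phi g) x) = x).
  { intros g x; rewrite <- pactM, <- hPhi, gmul_Vr; apply Phi1. }
  (* The altered action commutes with left multiplication by H because [beta] is constant on the
     cosets H x. *)
  assert (PhiH : forall g h x, H h -> pact (Phi g) (gmul h x) = gmul h (pact (Phi g) x)).
  { intros g h x Hh; revert g x.
    apply (amalgam_ind (fun g => forall x, pact (Phi g) (gmul h x) = gmul h (pact (Phi g) x))).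
    - split; [|split].
      + intro x; now rewrite !Phi1.
      + intros g g' E E' x; now rewrite hPhi, !pactM, E, E'.
      + intros g E x; rewrite <- (PhiV g x) at 1; now rewrite <- E, PhiV'.
    - intros a Aa x; rewrite !PhiA by auto; grp.
    - intros b Bb x; rewrite !PhiB by auto.
      rewrite (cocycle_coset _ hbeta) by auto; grp. }
  (* It permutes the cosets H x exactly as ordinary right multiplication does. *)
  assert (PhiC : forall g x, same_coset (pact (Phi g) x) (gmul x g)).
  { apply (amalgam_ind (fun g => forall x, same_coset (pact (Phi g) x) (gmul x g))).
    - split; [|split].
      + intro x; rewrite Phi1, gmul_1r; apply same_coset_refl.
      + intros g g' E E' x; rewrite hPhi, pactM, gmul_assoc.
        eapply same_coset_trans; [apply E'|now apply same_cosetM].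
      + intros g E x.
        specialize (E (pact (Phi (ginv g)) x)); rewrite PhiV in E.
        apply same_coset_sym, (same_cosetM _ _ (ginv g)) in E.
        now rewrite gmul_rassoc, gmul_Vr, gmul_1r in E.
    - intros a Aa x; rewrite PhiA by auto; apply same_coset_refl.
    - intros b Bb x; rewrite PhiB by auto; now apply cocycle_H. }
  assert (FC : forall x, same_coset (pact (Phi x) gone) x).
  { intro x; specialize (PhiC x gone); now rewrite gmul_1l in PhiC. }
  exists (fun g => pact (Phi g) gone).
  split; [apply Phi1|split; [|split; [|split]]].
  - intros x a Aa; now rewrite hPhi, pactM, PhiA.
  - intros x b Bb; rewrite hPhi, pactM, PhiB by auto.
    now rewrite (cocycle_same_coset _ x).
  - exact FC.
  (* F(x y) is the image of F(x) under y, and F(x), being in H, can be pulled out on the left. *)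
  - intros x y Hx Hy; rewrite hPhi, pactM, <- PhiH; [now rewrite gmul_1r|].
    apply (subM_cancel_r H _ (ginv x) SH); [insub|apply FC].
Qed.

End Cocycle.

(** The composite commutes with right multiplication by A and by B, hence by G, and it fixes 1. On B
    the two cocycles cancel because F'(x) lies in the coset of x. *)
Lemma twist_map_cancel (beta beta' : G -> G -> G) (F F' : G -> G) :
  twist_cocycle beta -> twist_cocycle beta' ->
  (forall x b, B b -> beta x (beta' x b) = b) ->
  F gone = gone -> F' gone = gone ->
  (forall x a, A a -> F (gmul x a) = gmul (F x) a) ->
  (forall x a, A a -> F' (gmul x a) = gmul (F' x) a) ->
  (forall x b, B b -> F (gmul x b) = gmul (F x) (beta x b)) ->
  (forall x b, B b -> F' (gmul x b) = gmul (F' x) (beta' x b)) ->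
  (forall x, same_coset (F' x) x) ->
  forall x, F (F' x) = x.
Proof.
  intros hb hb' K F1 F'1 FA F'A FB F'B F'C.
  assert (E : forall g x, F (F' (gmul x g)) = gmul (F (F' x)) g).
  { apply (amalgam_ind (fun g => forall x, F (F' (gmul x g)) = gmul (F (F' x)) g)).
    - split; [|split].
      + intro x; grp.
      + intros g g' E E' x; rewrite gmul_assoc, E', E; grp.
      + intros g E x; apply (gmul_cancel_r _ _ g); rewrite <- E; grp.
    - intros a Aa x; now rewrite F'A, FA.
    - intros b Bb x; rewrite F'B, FB by (auto; now apply cocycle_B).
      now rewrite (cocycle_same_coset _ hb _ x), K. }
  intro x; rewrite <- (gmul_1l x) at 1; rewrite E, F'1, F1; grp.
Qed.

Lemma twist_commensuration (beta beta' : G -> G -> G) :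
  twist_cocycle beta -> twist_cocycle beta' ->
  (forall x b, B b -> beta x (beta' x b) = b) ->
  (forall x b, B b -> beta' x (beta x b) = b) ->
  exists c : commensuration G,
    cdom c = H /\ cmap c gone = gone /\
    (forall x a, A a -> cmap c (gmul x a) = gmul (cmap c x) a) /\
    (forall x b, B b -> cmap c (gmul x b) = gmul (cmap c x) (beta x b)).
Proof.
  intros hb hb' K K'.
  destruct (twist_map beta hb) as (F & F1 & FA & FB & FC & hF).
  destruct (twist_map beta' hb') as (F' & F'1 & F'A & F'B & F'C & hF').
  assert (FH' : forall F0 x, (forall x, same_coset (F0 x) x) -> H x -> H (F0 x)).
  { intros F0 x E Hx; apply (subM_cancel_r H _ (ginv x) SH); [insub|apply E]. }
  unshelve eexists.
  - refine {| cdom := H; ccod := H; cmap := F; cinv := F' |}; auto.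
    + intros x _; now apply (twist_map_cancel beta' beta).
    + intros x _; now apply (twist_map_cancel beta beta').
  - simpl; auto.
Qed.

End Twist.

Let SC : subgroup C.
Proof.
  destruct amal as (_ & _ & EC & _).
  split; [|split].
  - apply one_in_C.
  - intros x y Cx Cy; apply EC in Cx, Cy; apply EC; split; insub; tauto.
  - intros x Cx; apply EC in Cx; apply EC; split; insub; tauto.
Qed.

(** * Twists by automorphisms and by coboundaries *)

Section NormalTwist.
Variable H : G -> Prop.
Hypothesis FH : finite_index H.
Hypothesis NH : forall x h, H h -> H (gmul x (gmul h (ginv x))).

Let SH : subgroup H. Proof. apply FH. Qed.

Lemma normal_mul_r x h : H h -> (H (gmul x h) <-> H x).
Proof. intro Hh; split; intro Hx; [now apply subM_cancel_r in Hx|insub]. Qed.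

Lemma normal_mul_l x h : H h -> (H (gmul h x) <-> H x).
Proof. intro Hh; split; intro Hx; [now apply subM_cancel_l in Hx|insub]. Qed.

(** As B lies in the normal subgroup H, right multiplication by B preserves each coset H x, so
    [alpha] may act on the coset H alone. *)
Lemma automorphism_cocycle (alpha : G -> G) :
  (forall b, B b -> H b) -> hom_on B alpha -> (forall b, B b -> B (alpha b)) ->
  (forall c, C c -> alpha c = c) ->
  twist_cocycle H (fun x b => if excluded_middle_informative (H x) then alpha b else b).
Proof.
  intros BH ha Ba aC; split.
  - intros h x b Hh; pose proof (normal_mul_l x h Hh).
    destruct (excluded_middle_informative (H (gmul h x)));
      destruct (excluded_middle_informative (H x)); tauto.
  - intros x b Bb; destruct (excluded_middle_informative (H x)); auto.
  - intros x b b' Bb Bb'; pose proof (normal_mul_r x b (BH b Bb)).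
    destruct (excluded_middle_informative (H (gmul x b)));
      destruct (excluded_middle_informative (H x)); auto; tauto.
  - intros x c Cc; destruct (excluded_middle_informative (H x)); auto.
  - intros x b Bb.
    set (b' := if excluded_middle_informative (H x) then alpha b else b).
    assert (Hb' : B b') by (unfold b'; destruct (excluded_middle_informative (H x)); auto).
    replace (gmul (gmul x b') (ginv (gmul x b)))
      with (gmul x (gmul (gmul b' (ginv b)) (ginv x))) by grp.
    apply NH, BH; insub.
Qed.

Lemma coboundary_cocycle (e : G -> G) :
  (forall c, C c -> H c) ->
  (forall c c', C c -> C c' -> gmul c c' = gmul c' c) ->
  (forall x, C (e x)) -> (forall h x, H h -> e (gmul h x) = e x) ->
  twist_cocycle H (fun x b => gmul (ginv (e x)) (gmul b (e (gmul x b)))).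
Proof.
  intros CH CC Ce eH.
  assert (Be : forall x, B (e x)) by (intro x; apply amalgam_sub_B, Ce).
  split.
  - intros h x b Hh; now rewrite gmul_rassoc, (eH h x), (eH h (gmul x b)).
  - intros x b Bb; specialize (Be x) as Be1; specialize (Be (gmul x b)) as Be2; insub.
  - intros x b b' _ _; grp.
  - intros x c Cc.
    replace (gmul x c) with (gmul (gmul x (gmul c (ginv x))) x) by grp.
    rewrite eH by auto; rewrite (CC c) by auto; grp.
  - intros x b _.
    replace (gmul (gmul x (gmul (ginv (e x)) (gmul b (e (gmul x b))))) (ginv (gmul x b)))
      with (gmul (gmul x (gmul (ginv (e x)) (ginv x)))
                 (gmul (gmul x b) (gmul (e (gmul x b)) (ginv (gmul x b))))) by grp.
    apply subM; auto; apply NH; insub.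
Qed.

Variables (M : nat) (t : G).
Hypotheses (UR : unique_root G) (M2 : (2 <= M)%nat).
Hypothesis ext : forall c : commensuration G, extends_coprimely M c.
Hypotheses (At : A t) (HtM : H (npow t M)).
Hypothesis Ht : forall m, H (npow t m) -> (Z.of_nat M | Z.of_nat m).

(** The twist fixes 1 and commutes with A, so it fixes the powers of t^M and
    [extends_coprimely_conj] applies. The element a is t^m, outside H because [M] does not divide
    m. *)
Lemma twist_equivariant (beta beta' : G -> G -> G) :
  twist_cocycle H beta -> twist_cocycle H beta' ->
  (forall x b, B b -> beta x (beta' x b) = b) ->
  (forall x b, B b -> beta' x (beta x b) = b) ->
  exists (F : G -> G) (a : G), A a /\ ~ H a /\
    F gone = gone /\
    (forall x a, A a -> F (gmul x a) = gmul (F x) a) /\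
    (forall x b, B b -> F (gmul x b) = gmul (F x) (beta x b)) /\
    (forall h, H h -> F (gmul a (gmul h (ginv a))) = gmul a (gmul (F h) (ginv a))).
Proof.
  intros hb hb' K K'.
  destruct (twist_commensuration H FH beta beta' hb hb' K K') as (c & Dc & F1 & FA & FB).
  destruct (extends_coprimely_conj UR M c t M2 (ext c)) as (m & Mm & E).
  - intro k; rewrite Dc, npow_mul; split; [insub|].
    rewrite <- (gmul_1l (npow (npow t M) k)) at 1; rewrite FA, F1 by insub; grp.
  - exists (cmap c), (npow t m); repeat split; auto.
    + insub.
    + intros h Hh; apply E; rewrite Dc; auto.
Qed.

(** In F(a b a^-1) the factor b is read on the coset H a, which is not H, and stays unchanged; in
    F(b) it is read on H and becomes alpha(b). Equivariance under conjugation by a equates the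
    two. *)
Lemma automorphism_trivial (alpha alpha' : G -> G) :
  (forall b, B b -> H b) ->
  hom_on B alpha -> (forall b, B b -> B (alpha b)) -> (forall b, B b -> B (alpha' b)) ->
  (forall b, B b -> alpha (alpha' b) = b) -> (forall b, B b -> alpha' (alpha b) = b) ->
  (forall c, C c -> alpha c = c) -> forall b, B b -> alpha b = b.
Proof.
  intros BH ha Ba Ba' K K' aC b Bb.
  assert (ha' : hom_on B alpha') by now apply (inverse_hom_on B B alpha).
  assert (aC' : forall c, C c -> alpha' c = c).
  { intros c Cc; rewrite <- (aC c Cc) at 1; apply K'; now apply amalgam_sub_B. }
  destruct (twist_equivariant _ _ (automorphism_cocycle alpha BH ha Ba aC)
    (automorphism_cocycle alpha' BH ha' Ba' aC')) as (F & a & Aa & Ha & F1 & FA & FB & E).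
  1, 2: intros x y By; destruct (excluded_middle_informative (H x)); auto.
  specialize (E b (BH b Bb)); rewrite gmul_assoc, FA, FB in E by insub.
  rewrite <- (gmul_1l a), <- (gmul_1l b), FA, FB, !F1, !gmul_1l in E by auto.
  destruct (excluded_middle_informative (H a)) as [|_]; [tauto|].
  destruct (excluded_middle_informative (H gone)) as [_|N1]; [|destruct N1; insub].
  rewrite gmul_rassoc in E; apply gmul_cancel_l, gmul_cancel_r in E; auto.
Qed.

(* Twisting by the function equal to [c] on [H] and to [1] elsewhere changes the
   commutator of [b] and [t], but not its conjugate by [a], in the [b]-syllable. *)
Lemma coboundary_trivial (b c : G) :
  B b -> (forall x, C x -> H x) ->
  (forall c c', C c -> C c' -> gmul c c' = gmul c' c) -> C c ->
  H (gmul b (gmul t (gmul (ginv b) (ginv t)))) ->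
  (forall a, A a -> ~ H (gmul a b)) -> ~ H t -> c = gone.
Proof.
  intros Bb CH CC Cc Hh Nb Nt.
  set (e := fun x => if excluded_middle_informative (H x) then c else gone).
  assert (e1 : forall x, H x -> e x = c).
  { intros x Hx; unfold e; destruct (excluded_middle_informative (H x)); tauto. }
  assert (e0 : forall x, ~ H x -> e x = gone).
  { intros x Hx; unfold e; destruct (excluded_middle_informative (H x)); tauto. }
  assert (Ce : forall x, C (e x)).
  { intro x; destruct (classic (H x)); [rewrite e1|rewrite e0]; insub. }
  assert (eH : forall h x, H h -> e (gmul h x) = e x).
  { intros h x Hh'; pose proof (normal_mul_l x h Hh').
    destruct (classic (H x)); [rewrite !e1|rewrite !e0]; tauto. }
  assert (hb : twist_cocycle H (fun x b => gmul (ginv (e x)) (gmul b (e (gmul x b)))))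
    by now apply coboundary_cocycle.
  assert (hb' : twist_cocycle H
    (fun x b => gmul (ginv (ginv (e x))) (gmul b (ginv (e (gmul x b)))))).
  { apply (coboundary_cocycle (fun x => ginv (e x))); auto.
    - intro x; specialize (Ce x); insub.
    - intros h x Hh'; now rewrite eH. }
  assert (eC : forall x y, same_coset H x y -> e x = e y).
  { intros x y E; rewrite <- (eH _ y E); f_equal; grp. }
  destruct (twist_equivariant _ _ hb hb') as (F & a & Aa & Ha & F1 & FA & FB & E).
  { intros x y By; rewrite (eC _ _ (cocycle_H _ _ hb' x y By)); grp. }
  { intros x y By; rewrite (eC _ _ (cocycle_H _ _ hb x y By)); grp. }
  specialize (E _ Hh).
  (* Of the prefixes at which [e] is evaluated below, the empty one lies in H, a b t b^-1 is
     undecided, and all others lie outside H. *)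
  assert (Nab : ~ H (gmul a (gmul b t))).
  { intro X; apply (Nb (gmul t a)); [insub|].
    apply (NH t) in X; now revert X; grp. }
  assert (Nb1 : ~ H b) by (intro X; apply (Nb gone); [insub|now rewrite gmul_1l]).
  assert (Nbt : ~ H (gmul b t)).
  { intro X; apply (Nb t); [insub|]. apply (NH t) in X; now revert X; grp. }
  assert (Nbtb : ~ H (gmul b (gmul t (ginv b)))).
  { intro X; apply Nt; apply (NH (ginv b)) in X; now revert X; grp. }
  replace (gmul a (gmul (gmul b (gmul t (gmul (ginv b) (ginv t)))) (ginv a)))
    with (gmul (gmul (gmul (gmul (gmul (gmul gone a) b) t) (ginv b)) (ginv t)) (ginv a))
    in E by grp.
  replace (gmul b (gmul t (gmul (ginv b) (ginv t))))
    with (gmul (gmul (gmul (gmul gone b) t) (ginv b)) (ginv t)) in E by grp.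
  rewrite (FA _ (ginv a)), !(FA _ (ginv t)), !(FB _ (ginv b)), !(FA _ t), !(FB _ b),
    (FA _ a), !F1 in E by insub.
  cbv beta in E; autorewrite with grp in E.
  rewrite (e1 gone), !(e0 b), !(e0 a), (e0 (gmul a b)), (e0 (gmul b t)),
    (e0 (gmul a (gmul b t))), (e0 (gmul b (gmul t (ginv b)))) in E by (auto; insub).
  autorewrite with grp in E.
  set (z := gmul a (gmul b (gmul t (ginv b)))) in E.
  apply gmul_cancel_l in E.
  assert (E' : gmul (ginv c) (gmul b (gmul t (ginv b))) =
               gmul (gmul b (gmul t (ginv b))) (e z)).
  { apply (gmul_cancel_r _ _ (gmul (ginv t) (ginv a))); grp. }
  (* If z is in H, then b t b^-1 inverts c; otherwise c^-1 = 1. *)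
  destruct (classic (H z)) as [Hz|Hz].
  - rewrite (e1 _ Hz) in E'; now apply unique_root_not_inverted in E'.
  - rewrite (e0 _ Hz), gmul_1r in E'.
    rewrite <- (gmul_1l (gmul b _)) in E' at 2.
    apply gmul_cancel_r in E'; now rewrite <- (ginvK c), E', ginv1.
Qed.

End NormalTwist.
End Amalgam.

(** * Homomorphisms modulo an integer *)

Section Congruence.
Context {G : Group}.
Implicit Types x y : G.

(** Integers up to congruence treat homomorphisms to Z and to Z/d alike; for d = 1 the condition is
    void. *)
Definition hom_mod (d : Z) (q : G -> Z) : Prop :=
  forall x y, (d | q (gmul x y) - (q x + q y)).

Lemma hom_mod1 d q : hom_mod d q -> (d | q gone).
Proof. intro hq; destruct (hq gone gone) as [k E]; rewrite gmul_1l in E; exists (- k); lia. Qed.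

Lemma hom_modV d q x : hom_mod d q -> (d | q (ginv x) + q x).
Proof.
  intro hq; destruct (hq (ginv x) x) as [k E]; destruct (hom_mod1 d q hq) as [l F].
  rewrite gmul_Vl in E; exists (l - k); lia.
Qed.

Lemma hom_mod_npow d q x n : hom_mod d q -> (d | q (npow x n) - Z.of_nat n * q x).
Proof.
  intro hq; induction n as [|n [k E]]; simpl npow.
  - destruct (hom_mod1 d q hq) as [l F]; exists l; lia.
  - destruct (hq x (npow x n)) as [l F]; exists (k + l); lia.
Qed.

Lemma hom_mod_subgroup d q : hom_mod d q -> subgroup (fun x => (d | q x)).
Proof.
  intro hq; split; [|split].
  - now apply hom_mod1.
  - intros x y [k E] [l F]; destruct (hq x y) as [j D]; exists (k + l + j); lia.
  - intros x [k E]; destruct (hom_modV d q x hq) as [j D]; exists (j - k); lia.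
Qed.

Lemma hom_mod_conj d q x h : hom_mod d q -> (d | q h) -> (d | q (gmul x (gmul h (ginv x)))).
Proof.
  intros hq [k E].
  destruct (hq x (gmul h (ginv x))) as [j1 D1]; destruct (hq h (ginv x)) as [j2 D2].
  destruct (hom_modV d q x hq) as [j3 D3]; exists (j1 + j2 + j3 + k); lia.
Qed.

Lemma hom_mod_commutator d q x y :
  hom_mod d q -> (d | q (gmul x (gmul y (gmul (ginv x) (ginv y))))).
Proof.
  intro hq.
  destruct (hq x (gmul y (gmul (ginv x) (ginv y)))) as [k1 E1].
  destruct (hq y (gmul (ginv x) (ginv y))) as [k2 E2].
  destruct (hq (ginv x) (ginv y)) as [k3 E3].
  destruct (hom_modV d q x hq) as [k4 E4]; destruct (hom_modV d q y hq) as [k5 E5].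
  exists (k1 + k2 + k3 + k4 + k5); lia.
Qed.

(** Modulo (M, d) the pair (p, q) is (1, 0) at t and (0, 1) at b, so the t^i b^j with i < M and j <
    d represent all cosets. *)
Lemma hom_mod_finite_index (M d : Z) (p q : G -> Z) (t b : G) :
  0 < M -> 0 < d -> hom_mod M p -> hom_mod d q ->
  p t = 1 -> p b = 0 -> (d | q t) -> (d | q b - 1) ->
  finite_index (fun x => (M | p x) /\ (d | q x)).
Proof.
  intros M0 d0 hp hq pt pb qt qb; split.
  - pose proof (hom_mod_subgroup M p hp) as S1; pose proof (hom_mod_subgroup d q hq) as S2.
    split; [|split].
    + split; [apply S1|apply S2].
    + intros x y [? ?] [? ?]; split; [now apply S1|now apply S2].
    + intros x [? ?]; split; [now apply S1|now apply S2].
  - exists (map (fun ij => gmul (npow t (fst ij)) (npow b (snd ij)))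
      (list_prod (seq 0 (Z.to_nat M)) (seq 0 (Z.to_nat d)))).
    intro x.
    pose proof (Z.mod_pos_bound (p x) M M0) as Bi.
    pose proof (Z.mod_pos_bound (q x) d d0) as Bj.
    set (i := Z.to_nat (p x mod M)); set (j := Z.to_nat (q x mod d)).
    exists (gmul (npow t i) (npow b j)); split; [|split].
    + apply (in_map (fun ij => gmul (npow t (fst ij)) (npow b (snd ij))) _ (i, j)).
      apply in_prod; apply in_seq; lia.
    + destruct (hp (ginv (gmul (npow t i) (npow b j))) x) as [k1 E1].
      destruct (hom_modV M p (gmul (npow t i) (npow b j)) hp) as [k2 E2].
      destruct (hp (npow t i) (npow b j)) as [k3 E3].
      destruct (hom_mod_npow M p t i hp) as [k4 E4].
      destruct (hom_mod_npow M p b j hp) as [k5 E5].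
      pose proof (Z.div_mod (p x) M) as E6.
      rewrite pt in E4; rewrite pb in E5.
      exists (k1 + k2 - k3 - k4 - k5 + p x / M); lia.
    + destruct (hq (ginv (gmul (npow t i) (npow b j))) x) as [k1 E1].
      destruct (hom_modV d q (gmul (npow t i) (npow b j)) hq) as [k2 E2].
      destruct (hq (npow t i) (npow b j)) as [k3 E3].
      destruct (hom_mod_npow d q t i hq) as [k4 E4].
      destruct (hom_mod_npow d q b j hq) as [k5 E5].
      destruct qt as [k6 E6]; destruct qb as [k7 E7].
      pose proof (Z.div_mod (q x) d) as E8.
      rewrite E6 in E4; replace (q b) with (1 + k7 * d) in E5 by lia.
      exists (k1 + k2 - k3 - k4 - Z.of_nat i * k6 - k5 - Z.of_nat j * k7 + q x / d); nia.
Qed.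

End Congruence.

(** * Choice of the subgroup and of the twist *)

Lemma zpow_Z_group (z : Z_group) (n : Z) : zpow z n = n * z.
Proof.
  revert n; apply Z.bi_induction.
  - now intros ? ? ->.
  - reflexivity.
  - intro n; rewrite zpow_succ; simpl; lia.
Qed.

Lemma hom_on_zpow (G K : Group) (D : G -> Prop) (f : G -> K) x n :
  subgroup D -> hom_on D f -> D x -> f (zpow x n) = zpow (f x) n.
Proof.
  intros SD hf Dx; destruct n; simpl.
  - now apply (hom_on1 D).
  - now apply (hom_on_npow D).
  - rewrite (hom_onV D) by (auto; insub); f_equal; now apply (hom_on_npow D).
Qed.

Theorem theorem4p4 (G : Group) (A B C : G -> Prop) :
  is_amalgam G A B C ->
  infinite_cyclic C ->
  ~ same_set C A ->
  ~ same_set C B ->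
  unique_root G ->
  quotient_surj_Z A C ->
  (abelian_on B -> surj_Z B) ->
  ~ comm_finitely_generated G.
Proof.
  intros amal (c & Cdef & cinf) _ CnB UR (phi & [hphi phisurj] & phiC) Babel FG.
  destruct (comm_fg_extends_coprimely UR FG) as (M & M2 & ext).
  assert (SA : subgroup A) by apply amal.
  assert (SB : subgroup B) by apply amal.
  assert (Cc : C c) by (apply Cdef; exists 1; now rewrite zpow1).
  assert (Bc : B c) by now apply (amalgam_sub_B amal).
  assert (CC : forall x y, C x -> C y -> gmul x y = gmul y x).
  { intros x y Cx Cy; apply Cdef in Cx, Cy.
    destruct Cx as [n ->], Cy as [m ->]; apply zpow_commute. }
  assert (c1 : c <> gone).
  { intro E; specialize (cinf 1); rewrite zpow1 in cinf; now apply cinf in E. }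
  (* [p] extends [phi] by 0 on B; the two agree on C because [phi] kills the normal closure of C. *)
  destruct (amalgam_ext amal Z_group phi (fun _ => 0)) as (p & hp & pA & pB).
  { exact hphi. }
  { now intros x y _ _. }
  { intros x Cx; apply phiC; split; [now apply (amalgam_sub_A amal)|auto]. }
  simpl in p; change (forall x y, p (gmul x y) = p x + p y) in hp.
  assert (hpM : hom_mod (Z.of_nat M) p) by (intros x y; exists 0; rewrite hp; lia).
  destruct (phisurj 1) as (t & At & phit).
  assert (pt : p t = 1) by now rewrite pA.
  assert (ptn : forall n, p (npow t n) = Z.of_nat n).
  { induction n as [|n IH]; simpl npow.
    - specialize (hp gone gone); rewrite gmul_1l in hp; simpl; lia.
    - rewrite hp, IH; lia. }
  assert (autB : forall alpha alpha' : G -> G,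
    hom_on B alpha -> (forall b, B b -> B (alpha b)) -> (forall b, B b -> B (alpha' b)) ->
    (forall b, B b -> alpha (alpha' b) = b) -> (forall b, B b -> alpha' (alpha b) = b) ->
    (forall x, C x -> alpha x = x) -> forall b, B b -> alpha b = b).
  { intros alpha alpha' ha Ba Ba' K K' aC.
    (* The condition modulo 1 is void, so this is the kernel of [p] modulo [M]; it contains B, where
       [p] vanishes. *)
    apply (automorphism_trivial amal (fun x => (Z.of_nat M | p x) /\ (1 | 0)))
      with M t alpha'; auto.
    - apply hom_mod_finite_index with t gone; auto; try lia.
      + intros x y; exists 0; lia.
      + rewrite pB; insub.
      + apply Z.divide_1_l.
      + apply Z.divide_1_l.
    - intros x h [Hh _]; split; [now apply hom_mod_conj|apply Z.divide_1_l].
    - rewrite ptn; split; [apply Z.divide_refl|apply Z.divide_1_l].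
    - intros m [Hm _]; now rewrite ptn in Hm.
    - intros b Bb; rewrite pB by auto; split; apply Z.divide_0_r. }
  (* Conjugation by an element of B that centralizes C is an automorphism of B fixing C, hence
     trivial. *)
  assert (conjB : forall z b, B z -> (forall x, C x -> gmul z x = gmul x z) -> B b ->
    gmul z b = gmul b z).
  { intros z b Bz Cz Bb.
    apply (gmul_cancel_r _ _ (ginv z)).
    transitivity b; [|grp].
    rewrite gmul_rassoc.
    apply (autB (fun b => gmul z (gmul b (ginv z))) (fun b => gmul (ginv z) (gmul b z)));
      auto.
    - intros x y _ _; grp.
    - intros x Bx; insub.
    - intros x Bx; insub.
    - intros x _; grp.
    - intros x _; grp.
    - intros x Cx; rewrite gmul_assoc, Cz by auto; grp. }
  (* Applied to elements of C, [conjB] makes C central in B; then it applies to every element of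
     B. *)
  assert (Bab : abelian_on B).
  { intros x y Bx By; apply conjB; auto; intros z Cz; symmetry; apply conjB; auto.
    now apply (amalgam_sub_B amal). }
  destruct (Babel Bab) as (psi & hpsi & psisurj).
  assert (hpsi' : hom_on B (psi : G -> Z_group)) by exact hpsi.
  destruct (psisurj 1) as (b & Bb & psib).
  destruct (Z.eq_dec (Z.abs (psi c)) 1) as [m1|m1].
  - assert (psicc : psi c * psi c = 1).
    { destruct (Z.abs_eq_cases _ 1 m1) as [-> | ->]; reflexivity. }
    (* With n = psi(b) psi(c), one has b = c^n k for some k in ker psi, because psi(c)^2 = 1;
       [alpha] sends c^n k to c^n k^-1. *)
    set (alpha := fun b => gmul (zpow c (2 * psi b * psi c)) (ginv b)).
    assert (Balpha : forall b, B b -> B (alpha b)) by (intros; unfold alpha; insub).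
    assert (psialpha : forall b, B b -> psi (alpha b) = psi b).
    { intros x Bx; unfold alpha; rewrite hpsi by insub.
      rewrite (hom_on_zpow _ Z_group B psi c) by auto.
      rewrite (hom_onV (K := Z_group) B psi) by auto.
      rewrite zpow_Z_group.
      change (2 * psi x * psi c * psi c + - psi x = psi x).
      rewrite <- Z.mul_assoc, psicc; lia. }
    assert (alphaK : forall b, B b -> alpha (alpha b) = b).
    { intros x Bx; unfold alpha at 1; rewrite psialpha by auto; unfold alpha; grp.
      rewrite gmul_assoc, (Bab _ x) by insub; grp. }
    assert (alphaid : forall b, B b -> alpha b = b).
    { apply autB with alpha; auto.
      - intros x y Bx By; unfold alpha; rewrite hpsi by auto.
        rewrite !Z.mul_add_distr_l, !Z.mul_add_distr_r, zpow_add, ginvM; grp.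
        f_equal; rewrite (Bab (ginv y)) by insub.
        rewrite !gmul_assoc; f_equal; apply Bab; insub.
      - intros x Cx; apply Cdef in Cx; destruct Cx as [n ->]; unfold alpha.
        rewrite (hom_on_zpow _ Z_group B psi c), zpow_Z_group by auto.
        rewrite <- zpow_opp, <- zpow_add; f_equal; nia. }
    apply CnB; intro x; split; [apply (amalgam_sub_B amal)|intro Bx].
    apply Cdef; exists (psi x * psi c).
    (* Triviality of [alpha] reads x^2 = c^(2n) with n = psi(x) psi(c). *)
    apply (UR _ _ 2%nat); [lia|].
    assert (E := alphaid x Bx); unfold alpha in E.
    simpl; rewrite !gmul_1r, <- zpow_add.
    rewrite <- E at 1; grp; f_equal; lia.
  - assert (Hd : exists d, 2 <= d /\ (d | psi c)).
    { destruct (Z.eq_dec (psi c) 0) as [->|c0].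
      - exists 2; split; [lia|apply Z.divide_0_r].
      - exists (Z.abs (psi c)); split; [lia|apply Z.divide_abs_l, Z.divide_refl]. }
    destruct Hd as (d & d2 & dc).
    assert (psiC : forall x, C x -> (d | psi x)).
    { intros x Cx; apply Cdef in Cx; destruct Cx as [n ->].
      rewrite (hom_on_zpow _ Z_group B psi c), zpow_Z_group by auto.
      now apply Z.divide_mul_r. }
    (* The trivial map on A and psi modulo d on B agree on C because d divides psi(c). *)
    destruct (amalgam_ext amal (Zmod_group d) (fun _ => gone)
      (fun x => exist _ (psi x mod d) (Zmod_mod _ _))) as (h & hh & hA & hB).
    { intros x y _ _; now rewrite gmul_1l. }
    { intros x y Bx By; apply sig_inj; simpl; now rewrite hpsi, <- Zplus_mod. }
    { intros x Cx; apply sig_inj; simpl; symmetry; apply Z.mod_divide; [lia|auto]. }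
    set (q := fun x => proj1_sig (h x)).
    assert (hq : hom_mod d q).
    { intros x y; unfold q; rewrite hh; simpl.
      set (s := proj1_sig (h x) + proj1_sig (h y)).
      exists (- (s / d)); pose proof (Z.div_mod s d); lia. }
    assert (qA : forall a, A a -> q a = 0) by (intros a Aa; unfold q; now rewrite hA).
    assert (qB : forall x, B x -> (d | q x - psi x)).
    { intros x Bx; unfold q; rewrite hB by auto; simpl.
      exists (- (psi x / d)); pose proof (Z.div_mod (psi x) d); lia. }
    (* G/H embeds in Z/M x Z/d, so H contains all commutators. For a in A, q(a b) is 1 modulo d, and
       p(t) = 1, so a b and t lie outside H. *)
    apply c1, (coboundary_trivial amal (fun x => (Z.of_nat M | p x) /\ (d | q x))) with M t b; auto.
    + apply hom_mod_finite_index with t b; auto; try lia.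
      * rewrite qA by auto; apply Z.divide_0_r.
      * rewrite <- psib; auto.
    + intros x y [? ?]; split; now apply hom_mod_conj.
    + rewrite ptn, qA by insub; split; [apply Z.divide_refl|apply Z.divide_0_r].
    + intros m [Hm _]; now rewrite ptn in Hm.
    + intros x Cx; split.
      * rewrite pB by now apply (amalgam_sub_B amal). apply Z.divide_0_r.
      * rewrite qA by now apply (amalgam_sub_A amal). apply Z.divide_0_r.
    + split; now apply hom_mod_commutator.
    + intros a Aa [_ [k E]]; destruct (hq a b) as [k1 E1]; destruct (qB b Bb) as [k2 E2].
      rewrite (qA a Aa) in E1.
      assert (D1 : (d | 1)) by (exists (k - k1 - k2); lia).
      apply Z.divide_1_r_nonneg in D1; lia.
    + rewrite pt; intros [D1 _]; apply Z.divide_1_r_nonneg in D1; lia.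
Qed.
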